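(* Let $V_{\mathbb{Q}}$ be a finite-dimensional $\mathbb{Q}$-vector space with a symmetric bilinear form $B:V_{\mathbb{Q}}\otimes V_{\mathbb{Q}}\to\mathbb{Q}$, and let $G$ be a finitely generated group acting linearly on $V_{\mathbb{Q}}$. Assume that there are elements $e_1,\dots,e_n\in V_{\mathbb{Q}}$ with $B(e_i,e_i)=2$ for all $i$, and generators $g_1,\dots,g_n$ of $G$ such that $g_i\cdot v=v-B(v,e_i)e_i$ for all $v\in V_{\mathbb{Q}}$ and all $i$. Then the restriction map $$H^1(G,V_{\mathbb{Q}})\to\prod_{g\in G}V_{\mathbb{Q}}/(g-\mathrm{id})V_{\mathbb{Q}}$$ is injective.
   Context: For a $G$-module $M$, $H^1(G,M)=Z^1(G,M)/B^1(G,M)$, where $Z^1(G,M)$ is the group of maps $\phi:G\to M$ with $\phi(gh)=g\cdot\phi(h)+\phi(g)$ for all $g,h\in G$, and $B^1(G,M)$ is the group of maps of the form $g\mapsto g\cdot x-x$ with $x\in M$. The restriction map takes the class of a $1$-cocycle $\phi$ to the element of the product with components $\phi(g)+(g-\mathrm{id})M$. *)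

(* Defs.v *)
From HB Require Import structures.
From mathcomp Require Import all_boot all_order all_algebra.
From mathcomp Require Import boolp functions.

Set Implicit Arguments.
Unset Strict Implicit.
Unset Printing Implicit Defensive.

Import GRing.Theory.
Local Open Scope ring_scope.
Local Open Scope quotient_scope.

(* Boolean predicates are arbitrary subsets here, as excluded middle is
   available in informative form. *)
Definition generates (G : groupType) (n : nat) (g : 'I_n -> G) : Prop :=
  forall H : {pred G}, group_closed H -> (forall i, g i \in H) ->
  forall x : G, x \in H.

Record gmodule (G : groupType) (M : zmodType) := GModule {
  gact :> G -> {additive M -> M};
  gact1 : forall v, gact 1%g v = v;
  gactM : forall g h v, gact (g * h)%g v = gact g (gact h v)
}.

Section H1.
Variables (G : groupType) (M : zmodType) (act : gmodule G M).

Definition is_cocycle : {pred G -> M} :=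
  fun phi => `[< forall g h, phi (g * h)%g = act g (phi h) + phi g >].

Fact is_cocycle_zmod_closed : zmod_closed is_cocycle.
Proof.
split=> [|phi psi /asboolP phiP /asboolP psiP]; apply/asboolP => g h.
  by rewrite raddf0 addr0.
rewrite /= -[(phi - psi) (g * h)%g]/(phi (g * h)%g - psi (g * h)%g) phiP psiP.
by rewrite -[(phi - psi) h]/(phi h - psi h) raddfB opprD addrACA.
Qed.
HB.instance Definition _ :=
  GRing.isZmodClosed.Build (G -> M) is_cocycle is_cocycle_zmod_closed.

Record Z1 := Cocycle { cocycle :> G -> M; _ : cocycle \in is_cocycle }.

HB.instance Definition _ := [isSub for cocycle].
HB.instance Definition _ := [Choice of Z1 by <:].
HB.instance Definition _ := [SubChoice_isSubZmodule of Z1 by <:].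

Definition B1 : {pred Z1} :=
  fun phi => `[< exists x : M, forall g, phi g = act g x - x >].

Fact B1_zmod_closed : zmod_closed B1.
Proof.
split=> [|phi psi /asboolP[x xP] /asboolP[y yP]]; apply/asboolP.
  by exists 0 => g; rewrite raddf0 subr0.
exists (x - y) => g; rewrite -[(phi - psi) g]/(phi g - psi g) xP yP (raddfB (act g)).
by rewrite !opprB [y - _]addrC addrACA [- x + y]addrC.
Qed.
HB.instance Definition _ := GRing.isZmodClosed.Build Z1 B1 B1_zmod_closed.

Definition H1 := Quotient.quot B1.
HB.instance Definition _ := GRing.Zmodule.on H1.

Definition subidM (g : G) : {pred M} :=
  fun v => `[< exists y : M, v = act g y - y >].

Fact subidM_zmod_closed g : zmod_closed (subidM g).
Proof.
split=> [|u v /asboolP[x ->] /asboolP[y ->]]; apply/asboolP.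
  by exists 0; rewrite raddf0 subr0.
by exists (x - y); rewrite (raddfB (act g)) !opprB [y - _]addrC addrACA [- x + y]addrC.
Qed.
HB.instance Definition _ g :=
  GRing.isZmodClosed.Build M (subidM g) (subidM_zmod_closed g).

Definition coinv (g : G) := Quotient.quot (subidM g).
HB.instance Definition _ g := GRing.Zmodule.on (coinv g).

(* Defined on the representative [repr c] of the class c; [restr_pi] shows that
   the choice of representative is irrelevant. *)
Definition restr (c : H1) : forall g : G, coinv g :=
  fun g => \pi_(coinv g) ((repr c : Z1) g).

Lemma restr_pi (phi : Z1) (g : G) :
  restr (\pi_H1 phi) g = \pi_(coinv g) (phi g).
Proof.
apply/eqP; rewrite /restr -Quotient.idealrBE.
have: repr (\pi_H1 phi) - phi \in B1 by rewrite Quotient.idealrBE reprK.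
by case/asboolP => x xP; apply/asboolP; exists x; rewrite -xP.
Qed.

End H1.

(* Main.v *)
(* Let phi be a cocycle that is locally a coboundary, choose a maximal linearly
   independent subfamily (e_i), i in S, and let w be the product of the
   corresponding g_i. Subtracting a coboundary we may assume phi(w) = 0, and
   independence then forces phi(g_i) = 0 for i in S. For any other j, write
   phi(g_j) = c e_j = phi(g_j w) = g_j w y - y; hence w y = y + t e_j for some
   scalar t, with c = - t - B(y, e_j). As w is an isometry, t (B(y, e_j) + t) = 0.
   If B(y, e_j) = - t then c = 0; if t = 0 then w fixes y, so y is orthogonal to
   all e_i with i in S, hence to e_j, and again c = 0. *)
Require Import Defs.
From mathcomp Require Import all_boot all_order all_algebra.
From mathcomp Require Import boolp functions.
From mathcomp Require Import ring.

Set Implicit Arguments.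
Unset Strict Implicit.
Unset Printing Implicit Defensive.

Import GRing.Theory.
Local Open Scope ring_scope.

(** Greedy choice: an index is kept only if its vector lies outside the span of those already
    kept. *)
Lemma span_free_subfamily (K : fieldType) (V : vectType K) (I : eqType)
    (e : I -> V) (s : seq I) :
  exists2 t : seq I, free (map e t) & {in s, forall i, e i \in <<map e t>>%VS}.
Proof.
elim: s => [|j s [t t_free st]]; first by exists [::]; rewrite ?nil_free.
have [jt|jt] := boolP (e j \in <<map e t>>%VS).
  by exists t => // i; rewrite inE => /predU1P[->|/st].
exists (j :: t) => [|i]; first by rewrite /= free_cons jt.
rewrite inE => /predU1P[->|/st it].
  by rewrite memv_span // mem_head.
by rewrite /= span_cons (subvP (addvSr _ _)).
Qed.

Section Cocycles.
Variables (G : groupType) (M : zmodType) (act : gmodule G M).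
Implicit Types phi : G -> M.

Lemma cocycleM phi x y : phi \in is_cocycle act ->
  phi (x * y)%g = act x (phi y) + phi x.
Proof. by move/asboolP. Qed.

Lemma cocycle1 phi : phi \in is_cocycle act -> phi 1%g = 0.
Proof.
move=> cphi; have := cocycleM 1%g 1%g cphi.
by rewrite mulg1 gact1 => /eqP; rewrite -subr_eq0 opprD addNKr oppr_eq0 => /eqP.
Qed.

Definition coboundary (x : M) : G -> M := fun g => act g x - x.

Lemma coboundary_cocycle x : coboundary x \in is_cocycle act.
Proof.
apply/asboolP => g h.
by rewrite /coboundary gactM (raddfB (act g)) addrA subrK.
Qed.

(** The zeros of a cocycle form a subgroup. *)
Lemma cocycle_eq0 n (g : 'I_n -> G) phi : generates g ->
  phi \in is_cocycle act -> (forall i, phi (g i) = 0) -> forall x, phi x = 0.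
Proof.
move=> g_gen cphi phig x; apply/eqP.
apply: (g_gen (fun x => phi x == 0)) => [|i]; last by apply/eqP/phig.
split=> [|a b /eqP phia /eqP phib]; first exact/eqP/cocycle1.
apply/eqP; rewrite (cocycleM _ _ cphi) phia addr0.
have := cocycleM b b^-1%g cphi; rewrite mulgV cocycle1 // phib addr0 => /esym bV.
have := cocycleM b^-1%g b cphi; rewrite mulVg cocycle1 // phib raddf0 add0r => <-.
exact: raddf0.
Qed.

End Cocycles.

Section Reflections.
Variables (K : fieldType) (V : vectType K) (B : {symmetric V}).
Variables (G : groupType) (act : gmodule G V).
Variables (I : eqType) (e : I -> V) (g : I -> G).
Hypothesis K2 : 2 != 0 :> K.
Hypothesis e_norm : forall i, B (e i) (e i) = 2.
Hypothesis g_refl : forall i v, act (g i) v = v - B v (e i) *: e i.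

(** A Coxeter-like product, folded so that induction on [s] strips the leftmost reflection. *)
Let w (s : seq I) := foldr (fun i x => g i * x)%g 1%g s.

Lemma symmetricC u v : B u v = B v u.
Proof. by rewrite hermC expr0 mul1r. Qed.

Lemma reflection_isometry i u v : B (act (g i) u) (act (g i) v) = B u v.
Proof.
rewrite !g_refl linearBl !linearBr /= !(linearZl_LR, linearZr_LR) /=.
by rewrite e_norm (symmetricC (e i) v); ring.
Qed.

Lemma reflections_isometry s u v : B (act (w s) u) (act (w s) v) = B u v.
Proof.
elim: s => [|i s IHs]; first by rewrite !gact1.
by rewrite /= !gactM reflection_isometry.
Qed.

(** Applying [g i] and then adding [phi (g i)] moves a vector only along [e i], so each factor
    contributes one line. *)
Lemma cocycle_reflections_span (phi : G -> V) s : phi \in is_cocycle act ->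
  (forall i, phi (g i) \in <[e i]>%VS) -> phi (w s) \in <<map e s>>%VS.
Proof.
move=> cphi phig; elim: s => [|i s IHs]; first by rewrite /= (cocycle1 cphi) mem0v.
rewrite /= span_cons (cocycleM _ _ cphi) g_refl -addrA addrC memv_add //.
by rewrite rpredD // rpredN rpredZ ?memv_line.
Qed.

(* For the affine action v |-> act x v + phi x: if the e i are linearly
   independent, a point fixed by a product of reflections is fixed by each of
   them. *)
Lemma cocycle_reflections_eq0 (phi : G -> V) s : phi \in is_cocycle act ->
  (forall i, phi (g i) \in <[e i]>%VS) -> free (map e s) -> phi (w s) = 0 ->
  {in s, forall i, phi (g i) = 0}.
Proof.
move=> cphi phig; elim: s => //= i s IHs; rewrite free_cons => /andP[eis s_free].
rewrite (cocycleM _ _ cphi) g_refl => phi0.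
(* By [phi0] this vector lies on the line of [e i]; it also lies in the span of the tail, which
   meets that line only in 0. *)
have ws0 : phi (w s) = 0.
  have /vlineP[k phiwE] : phi (w s) \in <[e i]>%VS.
    have -> : phi (w s) = B (phi (w s)) (e i) *: e i - phi (g i).
      by apply/eqP; rewrite -subr_eq0 opprB addrCA addrC phi0.
    by rewrite rpredB // rpredZ ?memv_line.
  have [k0|k0] := eqVneq k 0; first by rewrite phiwE k0 scale0r.
  case/negP: eis; rewrite -[e i](scalerK k0) -phiwE rpredZ //.
  exact: cocycle_reflections_span.
move=> j; rewrite inE => /predU1P[->|]; last exact: IHs.
by move: phi0; rewrite ws0 linear0l scale0r subr0 add0r.
Qed.

Lemma coboundary_reflection y i : coboundary act y (g i) = - B y (e i) *: e i.
Proof. by rewrite /coboundary g_refl addrC addKr scaleNr. Qed.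

Lemma coboundary_reflection_line y i : coboundary act y (g i) \in <[e i]>%VS.
Proof. by rewrite coboundary_reflection rpredZ ?memv_line. Qed.

Lemma reflection_neq0 i : e i != 0.
Proof. by apply: contra_neq K2 => ei0; rewrite -(e_norm i) ei0 linear0l. Qed.

Lemma orthogonal_span (s : seq I) y v : {in s, forall i, B y (e i) = 0} ->
  v \in <<map e s>>%VS -> B y v = 0.
Proof.
elim: s v => [|i s IHs] v ys.
  by rewrite span_nil memv0 => /eqP->; rewrite linear0r.
rewrite /= span_cons => /memv_addP[_ /vlineP[k ->] [u us ->]].
rewrite linearDr linearZr_LR /= ys ?mem_head // mulr0 add0r.
by apply: IHs us => j js; rewrite ys // inE js orbT.
Qed.

Lemma cocycle_dependent_reflection_eq0 (phi : G -> V) s j :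
  phi \in is_cocycle act -> free (map e s) -> e j \in <<map e s>>%VS ->
  phi (w s) = 0 -> phi (g j) \in <[e j]>%VS ->
  (exists y, phi (g j * w s)%g = act (g j * w s)%g y - y) -> phi (g j) = 0.
Proof.
move=> cphi s_free ejs phiw /vlineP[c phigE] [y].
rewrite (cocycleM _ _ cphi) phiw raddf0 add0r phigE gactM g_refl => yP.
(* Solving [yP] for [act (w s) y] leaves [y] plus this multiple of [e j]. *)
pose t := c + B (act (w s) y) (e j).
have wyE : act (w s) y = y + t *: e j.
  by rewrite /t scalerDl yP [_ - y + _]addrAC subrK [y + _]addrC subrK.
have cE : c = - t - B y (e j).
  have : t = c + B (y + t *: e j) (e j) by rewrite -wyE.
  rewrite linearDl linearZl_LR /= e_norm => tE.
  have -> : c = t - (B y (e j) + t * 2) by rewrite {1}tE addrK.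
  by ring.
have := reflections_isometry s y y.
rewrite wyE linearDl !linearDr /= !(linearZl_LR, linearZr_LR) /= e_norm.
rewrite (symmetricC (e j) y) => iso.
(* This is [B (w y) (w y) - B y y], expanded with [B (e j) (e j) = 2]. *)
have /eqP : 2 * (t * (B y (e j) + t)) = 0.
  by rewrite -(subrr (B y y)) -{1}iso; ring.
rewrite mulf_eq0 (negPf K2) mulf_eq0 /= => /orP[/eqP t0|/eqP Byt].
  rewrite cE t0 (@orthogonal_span s) // ?subrr ?oppr0 ?addr0 ?scale0r //.
  (* When [t = 0], the coboundary of [y] is itself a cocycle vanishing at [w s], so it vanishes at
     each [g i] with [i] in [s], which means [B y (e i) = 0]. *)
  have bndw : coboundary act y (w s) = 0.
    by rewrite /coboundary wyE t0 scale0r addr0 subrr.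
  move=> i si; have := cocycle_reflections_eq0 (coboundary_cocycle act y)
    (coboundary_reflection_line y) s_free bndw si.
  move/eqP; rewrite coboundary_reflection scaler_eq0 oppr_eq0.
  by rewrite (negPf (reflection_neq0 i)) orbF => /eqP.
have -> : c = 0 by rewrite cE -(addrK t (B y (e j))) Byt; ring.
by rewrite scale0r.
Qed.

End Reflections.

(** Two classes with equal restrictions have representatives whose difference is a coboundary at
    each single element, so a local-to-global statement for cocycles suffices. *)
Lemma restr_injective (G : groupType) (M : zmodType) (act : gmodule G M) :
  (forall phi : G -> M, phi \in is_cocycle act ->
     (forall x, exists y, phi x = act x y - y) ->
     exists z, forall x, phi x = act x z - z) ->
  injective (restr (act := act)).
Proof.
move=> locP c d; rewrite -[c]reprK -[d]reprK.
move: (repr c) (repr d) => {c d} phi psi eq_restr.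
apply/eqP; rewrite -Quotient.idealrBE; apply/asboolP.
apply: (locP (cocycle (phi - psi))) => [|x]; first exact: valP.
apply/asboolP; rewrite -[asbool _]/((phi x - psi x) \in subidM act x).
by rewrite Quotient.idealrBE -!restr_pi eq_restr.
Qed.

Theorem proposition8 (V : vectType rat) (B : {symmetric V})
    (G : groupType) (act : gmodule G V)
    (act_linear : forall g : G, linear (act g))
    (n : nat) (e : 'I_n -> V) (g : 'I_n -> G)
    (e_norm : forall i, B (e i) (e i) = 2)
    (g_gen : generates g)
    (g_refl : forall (i : 'I_n) (v : V), act (g i) v = v - B v (e i) *: e i) :
  injective (restr (act := act)).
Proof.
apply: restr_injective => phi cphi phi_loc.
have [t t_free et] := span_free_subfamily e (enum 'I_n).
pose w := foldr (fun i x => g i * x)%g 1%g t.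
have [z phiw] := phi_loc w.
exists z => x; apply/eqP; rewrite -subr_eq0; apply/eqP.
pose psi := phi - coboundary act z.
have psiE y : psi y = phi y - (act y z - z) by [].
have cpsi : psi \in is_cocycle act by rewrite rpredB ?coboundary_cocycle.
have psi_loc y : exists u, psi y = act y u - u.
  have [u phiy] := phi_loc y; exists (u - z).
  by rewrite psiE phiy (raddfB (act y)) !opprD addrACA.
rewrite -psiE; apply: (cocycle_eq0 g_gen cpsi) => i.
apply: (cocycle_dependent_reflection_eq0 _ e_norm g_refl cpsi t_free) => //.
- by rewrite et ?mem_enum.
- by rewrite psiE phiw subrr.
(* Local triviality at [g i] itself puts [psi (g i)] on the line of [e i]. *)
- have [u ->] := psi_loc (g i); exact: (coboundary_reflection_line g_refl).
Qed.
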